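(* There exists an absolute constant $A>0$ such that for every separable Hilbert space $\mathcal X$ with norm $\|\cdot\|$, every $f\in\mathcal M_{ind}(\mathcal X)$ with $\mathbf E d_j=0$ for all $j=1,2,\ldots$, every $p\ge2$, every $c$ with $1\le c\le p$ and every $n=1,2,\ldots$, $$\big\|\,\|f_n\|\,\big\|_p\le A\left(c\|S_p\|_p+\sqrt c\,e^{p/c}\|S_2\|_2\right);$$ in particular, $$\big\|\,\|f_n\|\,\big\|_p\le A\left(p\|S_p\|_p+\sqrt p\,\|S_2\|_2\right),$$ $$\big\|\,\|f_n\|\,\big\|_p\le A\,\frac p{\ln p}\left(\|S_p\|_p+\|S_2\|_2\right),$$ $$\big\|\,\|f_n\|\,\big\|_p\le A\left(\alpha\|S_p\|_p+e^{p/\alpha}\|S_2\|_2\right)\qquad\text{for all }\alpha\text{ with }1\le\alpha\le\frac p{\ln(ep)}.$$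
   Context: For a separable Banach space $\mathcal X$, $\mathcal M_{ind}(\mathcal X)$ is the class of all sequences $f=(f_0,f_1,\ldots)$ of Bochner-integrable random vectors in $\mathcal X$ (on some probability space, which may depend on $f$) with $f_0\equiv0$ whose increments $d_j=f_j-f_{j-1}$, $j=1,2,\ldots$, are independent. For $q>0$ put $S_q=\left(\sum_{j=1}^\infty\|d_j\|^q\right)^{1/q}$. For a real random variable $Y$, $\|Y\|_p=(\mathbf E|Y|^p)^{1/p}\in[0,\infty]$. *)

(* Defs.v *)
From HB Require Import structures.
From mathcomp Require Import all_boot all_order all_algebra.
From mathcomp Require Import finmap.
From mathcomp Require Import all_classical all_reals all_analysis.

Set Implicit Arguments.
Unset Strict Implicit.
Unset Printing Implicit Defensive.

Import Order.TTheory GRing.Theory Num.Theory.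
Import numFieldNormedType.Exports.

Local Open Scope classical_set_scope.
Local Open Scope ring_scope.

Definition separable_space (T : topologicalType) : Prop :=
  exists D : set T, countable D /\ dense D.

(* Completeness is carried by the type, so an inner product inducing the norm
   is what remains to be asked. *)
Definition is_hilbert (R : realType) (H : completeNormedModType R) : Prop :=
  exists dot : {dot H for idfun}, forall x : H, `|x| = Num.sqrt (dot x x).

Notation borelType T := (g_sigma_algebraType (@open T)).

Section random_vectors.
Context (R : realType) (H : completeNormedModType R).
Context (d : measure_display) (T : measurableType d) (P : probability T R).
Implicit Types (X : T -> H) (f : nat -> T -> H).

Definition random_vector X : Prop :=
  measurable_fun [set: T] (X : T -> borelType H).

Definition simple_vector X : Prop :=
  random_vector X /\ finite_set (range X).

Definition simple_expectation X : H :=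
  \sum_(x \in range X) fine (P (X @^-1` [set x])) *: x.

(* For a non-measurable integrand the library integral is only a lower
   integral, so this is meant for random vectors X. *)
Definition simple_approx X (s : nat -> T -> H) : Prop :=
  (forall k, simple_vector (s k)) /\
  (\int[P]_w (`|X w - s k w|)%:E)%E @[k --> \oo] --> 0%E.

Definition bochner_integrable X : Prop :=
  random_vector X /\ exists s, simple_approx X s.

(* The Bochner expectation of X exists and equals v. *)
Definition has_expectation X (v : H) : Prop :=
  random_vector X /\
  exists2 s, simple_approx X s & simple_expectation (s k) @[k --> \oo] --> v.

Definition independent_vectors (I : set nat) (X : nat -> T -> H) : Prop :=
  forall (J : {fset nat}) (B : nat -> set (borelType H)),
    (forall j, j \in J -> I j) ->
    (forall j, j \in J -> measurable (B j)) ->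
    P (\bigcap_(j in [set` J]) (X j @^-1` B j)) =
    (\prod_(j <- J) P (X j @^-1` B j))%E.

(* Meaningful for j >= 1; the truncated predecessor makes increment f 0 = 0. *)
Definition increment f (j : nat) : T -> H := fun w => f j w - f j.-1 w.

Record M_ind f : Prop := {
  M_ind0 : forall w, f 0%N w = 0 ;
  M_ind_integrable : forall j, bochner_integrable (f j) ;
  M_ind_independent : independent_vectors [set j | (1 <= j)%N] (increment f) }.

Definition S_ f (q : R) : T -> \bar R := fun w =>
  ((\sum_(1 <= j <oo) (`|increment f j w| `^ q)%:E) `^ q^-1)%E.

End random_vectors.

(* Main.v *)
Require Import Defs.
From HB Require Import structures.
From mathcomp Require Import all_boot all_order all_algebra.
From mathcomp Require Import finmap ring lra.
From mathcomp Require Import all_classical all_reals all_analysis.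
From mathcomp Require Import measurable_realfun.

Import Order.TTheory GRing.Theory Num.Theory.
Import numFieldNormedType.Exports.

Local Open Scope classical_set_scope.
Local Open Scope ring_scope.

Set Implicit Arguments.
Unset Strict Implicit.
Unset Printing Implicit Defensive.

(** Why the theorem is true.  Put q = p - 2, let b_j = E|d_j|^2 and
    a_j = E|d_j|^p, and let B and V be the sums of the b_j and of the a_j over
    j <= n, so that B <= ||S_2||_2^2 and V <= ||S_p||_p^p.  In a Hilbert space
    the function |x|^p has the second-order expansion
      |x + y|^p <= |x|^p + p |x|^q <x, y> + p^2 (|x| + |y|)^q |y|^2,
    and the linear term disappears on averaging over a centred y that is
    independent of x.  The exponential factor of the theorem comes from
    splitting the quadratic term: according to whether c|y| <= |x| or not,
      (|x| + |y|)^q <= e^(p/c) |x|^q + (2c)^q |y|^q.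
    For an arbitrary level l > 0 one also has |x|^q <= |x|^p / l^2 + l^q, which
    makes the estimate affine in |x|^p ([powR_one_step]).

    Averaging, with u = p^2 e^(p/c) and v = p^2 (2c)^q, the moments
    M_k = E|f_k|^p satisfy the linear recursion
      M_k <= (1 + u b_k / l^2) M_(k-1) + u l^q b_k + v a_k
    ([indep_sum_moment_le]), hence by the discrete Gronwall argument
      M_n <= e^(u B / l^2) (u l^q B + v V)        ([partial_sum_moment_le]).
    If l^2 is at least 2 u B / p = 2 p e^(p/c) B, the right-hand side is at most
    (e^(5/2) (l + 2 c V^(1/p)))^p ([moment_bound_le]).  Since p/c <= e^(p/c),
    the choice l = 2 sqrt(c) e^(p/c) ||S_2||_2 + (something tiny) is admissible,
    and the first inequality follows ([Lnorm_partial_sum_le]).  The others are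
    special choices of c: c = p for the second one, the smaller of 4p / ln p and
    p for the third ([choice_p_over_ln]) and the smaller of 2 alpha and p for
    the fourth ([choice_alpha]).

    On the measure-theoretic side, separability of the space makes addition
    measurable for the product of the Borel sigma-algebras
    ([measurable_borel_add]).  This gives, by induction on k, that f_k is
    independent of the later increments ([partial_sum_indep]), and it allows
    Tonelli's theorem to be applied to |x + y|^p under the joint law of
    (f_(k-1), d_k), which is a product ([integral_indep_pair]).  That the linear
    term averages to 0 follows because bounded linear functionals commute with
    the Bochner expectation ([integral_functional]). *)

(** * Inequalities for real powers *)

(** Convexity of the power [s]: its graph lies above the tangent at [x].  In
    this form the inequality is Young's inequality for the conjugate exponents
    [s / (s - 1)] and [s], so no derivative is needed. *)
Lemma powR_tangent (R : realType) (s x y : R) : 1 <= s -> 0 <= x -> 0 <= y ->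
  s * (x `^ (s - 1) * y) <= (s - 1) * x `^ s + y `^ s.
Proof.
rewrite le_eqVlt => /predU1P[<- x0 y0|s1 x0 y0].
  by rewrite subrr powRr0 !mul1r mul0r add0r powRr1.
have s0 : 0 < s by lra.
have s10 : 0 < s - 1 by lra.
have t0 : 0 < s / (s - 1) by rewrite divr_gt0.
have := @conjugate_powR R (x `^ (s - 1)) y (s / (s - 1)) s (powR_ge0 _ _) y0 t0 s0.
have -> : (s / (s - 1))^-1 + s^-1 = 1 by field; rewrite !gt_eqF.
move=> /(_ erefl); rewrite -powRrM (_ : (s - 1) * (s / (s - 1)) = s); last first.
  by field; rewrite gt_eqF.
rewrite -(ler_pM2l s0) => /le_trans; apply.
by rewrite le_eqVlt; apply/orP; left; apply/eqP; field; rewrite !gt_eqF.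
Qed.

Lemma powRD2 (R : realType) (a q : R) : 0 <= a -> 0 <= q ->
  a `^ (q + 2) = a `^ q * a ^+ 2.
Proof.
move=> a0 q0; rewrite powRD; last by rewrite gt_eqF// ltr_wpDl.
by rewrite powR_mulrn.
Qed.

(** The factor [hi] on the left makes one bound valid for all [q >= 0], although
    the power [q] is concave for [q < 1] and convex for [q > 1]: it is the
    tangent inequality for the exponent [q + 1 >= 1]. *)
Lemma powR_increment_le (R : realType) (q lo hi : R) : 0 <= q -> 0 <= lo -> lo <= hi ->
  (hi `^ q - lo `^ q) * hi <= (q + 1) * (hi `^ q * (hi - lo)).
Proof.
move=> q0 l0 lh; have h0 := le_trans l0 lh.
have q1 : 1 <= q + 1 by lra.
have := powR_tangent q1 h0 l0.
have q10 : 0 < q + 1 by lra.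
rewrite -(mulr_powRB1 h0 q10) -(mulr_powRB1 l0 q10) !addrK.
have : lo * lo `^ q <= hi * lo `^ q by rewrite ler_wpM2r ?powR_ge0.
nra.
Qed.

(** Second-order expansion of the [p]-th power of a norm, stated for numbers:
    [a], [b], [t], [h] stand for |x|, |y|, |x + y| and <x, y>.  It is the tangent
    inequality for the exponent [p / 2] between the squares [a ^+ 2] and
    [t ^+ 2], where [t ^+ 2 - a ^+ 2] is explicit; the error made by taking the
    slope at [t] instead of [a] is of second order in [b]. *)
Lemma powR_taylor2 (R : realType) (p a b t h : R) : 2 <= p ->
  0 <= a -> 0 <= b -> 0 <= t -> `|t - a| <= b ->
  t ^+ 2 = a ^+ 2 + 2 * h + b ^+ 2 ->
  t `^ p <= a `^ p + p * (a `^ (p - 2) * h) + p ^+ 2 * ((a + b) `^ (p - 2) * b ^+ 2).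
Proof.
move=> p2 a0 b0 t0 tab tE.
set q := p - 2; have q0 : 0 <= q by rewrite /q; lra.
have pE : p = q + 2 by rewrite /q; lra.
have r1 : 1 <= p / 2 by lra.
have sq (x : R) : 0 <= x -> (x ^+ 2) `^ (p / 2) = x `^ q * x ^+ 2.
  move=> x0; rewrite -powRD2// -(powR_mulrn 2 x0) -powRrM.
  by congr (_ `^ _); rewrite /q; field.
have sq' (x : R) : 0 <= x -> (x ^+ 2) `^ (p / 2 - 1) = x `^ q.
  move=> x0; rewrite -(powR_mulrn 2 x0) -powRrM.
  by congr (_ `^ _); rewrite /q; field.
have := powR_tangent r1 (sqr_ge0 t) (sqr_ge0 a).
rewrite !sq// sq'//.
have pw (x : R) : 0 <= x -> x `^ p = x `^ q * x ^+ 2.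
  by move=> x0; rewrite -powRD2// -pE.
rewrite !pw//.
have AM : a `^ q <= (a + b) `^ q by rewrite ge0_ler_powR ?nnegrE//; lra.
have tM : t <= a + b by move: tab; rewrite ler_norml => /andP[]; lra.
have TM : t `^ q <= (a + b) `^ q by rewrite ge0_ler_powR ?nnegrE//; lra.
have A0 := powR_ge0 a q; have T0 := powR_ge0 t q.
set A := a `^ q in AM A0 *; set T := t `^ q in TM T0 *; set M := (a + b) `^ q in AM TM *.
(* The error term: both factors are increments from [a] to [t], of size at
   most [b]. *)
have cross : (T - A) * (t ^+ 2 - a ^+ 2) <= 2 * (q + 1) * (M * b ^+ 2).
  have key lo hi : 0 <= lo -> lo <= hi -> hi - lo <= b -> hi `^ q <= M ->
      (hi `^ q - lo `^ q) * (hi ^+ 2 - lo ^+ 2) <= 2 * (q + 1) * (M * b ^+ 2).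
    move=> l0 lh hb hM; have h0 := le_trans l0 lh.
    have inc := powR_increment_le q0 l0 lh.
    have : lo `^ q <= hi `^ q by rewrite ge0_ler_powR ?nnegrE.
    have := powR_ge0 hi q.
    set X := hi `^ q in hM inc *; set Y := lo `^ q in inc * => X0 YX.
    have e1 : (X - Y) * (hi ^+ 2 - lo ^+ 2) <= ((X - Y) * hi) * (2 * (hi - lo)).
      rewrite (_ : hi ^+ 2 - lo ^+ 2 = (hi + lo) * (hi - lo)); last by ring.
      rewrite -!mulrA; apply: ler_wpM2l; first lra.
      rewrite mulrA; apply: ler_wpM2r; lra.
    apply: (le_trans e1); apply: (@le_trans _ _ ((q + 1) * (X * (hi - lo)) * (2 * (hi - lo)))).
      by apply: ler_wpM2r => //; lra.
    rewrite (_ : _ * _ = 2 * (q + 1) * (X * (hi - lo) ^+ 2)); last by ring.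
    apply: ler_wpM2l; first lra.
    by apply: ler_pM => //; [exact: sqr_ge0|rewrite ler_sqr ?nnegrE; lra].
  case/orP: (le_total a t) => at_.
    by apply: key => //; move: tab; rewrite ler_norml => /andP[]; lra.
  rewrite -mulrNN !opprB; apply: key => //.
  by move: tab; rewrite ler_norml => /andP[]; lra.
move=> tan.
have AMb : A * b ^+ 2 <= M * b ^+ 2 by rewrite ler_wpM2r ?sqr_ge0.
have Mb0 : 0 <= M * b ^+ 2 by rewrite mulr_ge0 ?sqr_ge0//; lra.
have c2 : p / 2 * ((T - A) * (t ^+ 2 - a ^+ 2)) <= p / 2 * (2 * (q + 1) * (M * b ^+ 2)).
  by apply: ler_wpM2l => //; lra.
have c3 : p / 2 * (A * b ^+ 2) <= p / 2 * (M * b ^+ 2) by apply: ler_wpM2l => //; lra.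
have c4 : 0 <= p / 2 * (M * b ^+ 2) by rewrite mulr_ge0//; lra.
have e : p / 2 * (T * (t ^+ 2 - a ^+ 2)) = p * (A * h) + p / 2 * (A * b ^+ 2)
     + p / 2 * ((T - A) * (t ^+ 2 - a ^+ 2)).
  have -> : t ^+ 2 - a ^+ 2 = 2 * h + b ^+ 2 by rewrite tE; ring.
  by field.
have e2 : p / 2 * (2 * (q + 1) * (M * b ^+ 2)) = p ^+ 2 * (M * b ^+ 2) - p * (M * b ^+ 2).
  by rewrite pE; field.
nra.
Qed.

(** Either [b <= a / c], and [(1 + 1/c) ^ q] is at most [e ^ (q / c)], or
    [a < c b], and [a + b <= 2 c b].  This is where the trade-off parameter [c]
    of the theorem enters. *)
Lemma powR_add_le (R : realType) (q c a b : R) : 0 <= q -> 1 <= c -> 0 <= a -> 0 <= b ->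
  (a + b) `^ q <= expR (q / c) * a `^ q + (2 * c) `^ q * b `^ q.
Proof.
move=> q0 c1 a0 b0; have c0 : 0 < c by lra.
have [bca|bca] := leP (c * b) a.
  apply: (@le_trans _ _ (expR (q / c) * a `^ q)); last first.
    by rewrite lerDl mulr_ge0 ?powR_ge0.
  have -> : expR (q / c) = expR c^-1 `^ q by rewrite -expRM mulrC.
  rewrite -powRM ?expR_ge0//; apply: ge0_ler_powR; rewrite ?nnegrE ?mulr_ge0 ?expR_ge0//.
    exact: addr_ge0.
  apply: (@le_trans _ _ ((1 + c^-1) * a)); last by rewrite ler_wpM2r ?expR_ge1Dx.
  by rewrite mulrDl mul1r lerD2l mulrC ler_pdivlMr// mulrC.
apply: (@le_trans _ _ ((2 * c) `^ q * b `^ q)); last first.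
  by rewrite lerDr mulr_ge0 ?powR_ge0 ?expR_ge0.
rewrite -powRM//; last by lra.
by apply: ge0_ler_powR; rewrite ?nnegrE ?mulr_ge0//; nra.
Qed.

(** Trading the power [q] for the power [q + 2] at the price of a constant; it
    turns the moment recursion into a linear one. *)
Lemma powR_interpolation (R : realType) (q a l : R) : 0 <= q -> 0 <= a -> 0 < l ->
  a `^ q <= a `^ (q + 2) / l ^+ 2 + l `^ q.
Proof.
move=> q0 a0 l0; have l20 : 0 < l ^+ 2 by rewrite exprn_gt0.
have [al|la] := leP a l.
  apply: (@le_trans _ _ (l `^ q)); first by rewrite ge0_ler_powR ?nnegrE// ltW.
  by rewrite lerDr divr_ge0 ?powR_ge0 ?ltW.
apply: (@le_trans _ _ (a `^ (q + 2) / l ^+ 2)); last by rewrite lerDl powR_ge0.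
by rewrite powRD2// -mulrA ler_peMr ?powR_ge0// ler_pdivlMr// mul1r ler_sqr ?nnegrE// ltW.
Qed.

(** [quad_coef] and [pow_coef] are the coefficients u and v with which the second
    moment and the [p]-th moment of an increment enter the recursion. *)
Definition quad_coef (R : realType) (p c : R) := p ^+ 2 * expR (p / c).
Definition pow_coef (R : realType) (p c : R) := p ^+ 2 * (2 * c) `^ (p - 2).

(** The preceding expansion after both splittings: apart from the linear term in
    [h], the bound is affine in [a `^ p]. *)
Lemma powR_one_step (R : realType) (p c l a b t h : R) : 2 <= p -> 1 <= c -> 0 < l ->
  0 <= a -> 0 <= b -> 0 <= t -> `|t - a| <= b ->
  t ^+ 2 = a ^+ 2 + 2 * h + b ^+ 2 ->
  t `^ p <= a `^ p + p * a `^ (p - 2) * h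
    + quad_coef p c * (a `^ p / l ^+ 2 + l `^ (p - 2)) * b ^+ 2
    + pow_coef p c * b `^ p.
Proof.
move=> p2 c1 l0 a0 b0 t0 tab tE.
have q0 : 0 <= p - 2 by lra.
apply: (le_trans (powR_taylor2 p2 a0 b0 t0 tab tE)).
rewrite -!addrA lerD2l mulrA lerD2l /quad_coef /pow_coef.
set K := a `^ p / l ^+ 2 + _; set B := b `^ p.
rewrite [leRHS](_ : _ =
    p ^+ 2 * (expR (p / c) * K * b ^+ 2 + (2 * c) `^ (p - 2) * B)); last by ring.
apply: ler_wpM2l; first exact: sqr_ge0.
apply: (@le_trans _ _ ((expR ((p - 2) / c) * a `^ (p - 2) +
    (2 * c) `^ (p - 2) * b `^ (p - 2)) * b ^+ 2)).
  by apply: ler_wpM2r; rewrite ?sqr_ge0//; apply: powR_add_le.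
rewrite mulrDl -[X in _ + X]mulrA -powRD2// subrK lerD2r.
apply: ler_wpM2r; first exact: sqr_ge0.
apply: ler_pM; rewrite ?expR_ge0 ?powR_ge0//.
  by rewrite ler_expR ler_wpM2r// ?invr_ge0; lra.
by apply: (le_trans (powR_interpolation q0 a0 l0)); rewrite subrK.
Qed.

(** * Pairs of independent random elements *)

(** Packages the image of [m] under [f] as a measure, which [pushforward] alone
    is only when measurability of [f] is known. *)
Lemma image_measure d1 d2 (T1 : measurableType d1) (T2 : measurableType d2)
    (R : realType) (m : {measure set T1 -> \bar R}) (f : T1 -> T2) :
  measurable_fun setT f ->
  exists m' : {measure set T2 -> \bar R}, forall A, m' A = m (f @^-1` A).
Proof.
move=> mf; unshelve (exists (pushforward m f)) => //.
Qed.

Section pairs.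
Context d d1 d2 (T : measurableType d) (T1 : measurableType d1) (T2 : measurableType d2).
Context (R : realType) (P : probability T R).
Variables (X : T -> T1) (Y : T -> T2).
Hypotheses (mX : measurable_fun setT X) (mY : measurable_fun setT Y).

Let Z w := (X w, Y w).

Let mZ : measurable_fun setT Z.
Proof. exact: measurable_fun_pair. Qed.

(** Both sides, as functions of [C], are finite measures on the product that agree
    on the pi-system of measurable rectangles. *)
Lemma pair_indep_rectangles (E : set T) : measurable E ->
  (forall A B, measurable A -> measurable B ->
    P (X @^-1` A `&` Y @^-1` B `&` E) = P (X @^-1` A `&` Y @^-1` B) * P E)%E ->
  forall C, measurable C ->
    P ((fun w => (X w, Y w)) @^-1` C `&` E) =
    (P ((fun w => (X w, Y w)) @^-1` C) * P E)%E.
Proof.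
move=> mE rect C mC.
pose r : {nonneg R} := NngNum (fine_ge0 (measure_ge0 P E)).
have rE : (r%:num)%:E = P E by rewrite /= fineK// fin_num_measure.
have [mrec mrecE] : exists m : {measure set (T1 * T2) -> \bar R},
    forall A, m A = P (Z @^-1` A `&` E).
  have [m mE'] := image_measure (mrestr P mE) mZ.
  by exists m => A; rewrite mE'.
have [mr2 mr2E] : exists m : {measure set (T1 * T2) -> \bar R},
    forall A, m A = (P (Z @^-1` A) * P E)%E.
  have [m mE'] := image_measure P mZ.
  by exists (mscale r m) => A; rewrite [LHS]/= /mscale mE' rE muleC.
rewrite -mrecE -mr2E.
pose G := [set A `*` B | A in @measurable _ T1 & B in @measurable _ T2].
apply: (measure_unique G (fun=> setT)) => //.
- exact: measurable_prod_measurableType.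
- move=> _ _ [A1 mA1 [B1 mB1 <-]] [A2 mA2 [B2 mB2 <-]]; rewrite -setXI.
  exists (A1 `&` A2); first exact: measurableI.
  by exists (B1 `&` B2) => //; exact: measurableI.
- by move=> _; exists setT => //; exists setT => //; rewrite setXTT.
- by rewrite bigcup_const.
- by move=> _ [A mA [B mB <-]]; rewrite mrecE mr2E; exact: rect.
- by move=> _; rewrite mrecE; rewrite preimage_setT setTI ltey_eq fin_num_measure.
Qed.

Lemma measurable_section_integral (F : T1 * T2 -> \bar R) :
  measurable_fun setT F -> (forall z, 0 <= F z)%E ->
  measurable_fun setT (fun w => \int[P]_w' F (X w, Y w'))%E.
Proof.
move=> mF F0.
pose Y' : {mfun T >-> T2} := HB.pack Y (isMeasurableFun.Build _ _ _ _ _ mY).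
have mG := @measurable_fun_fubini_tonelli_F _ _ _ _ _ (distribution P Y') F mF F0.
rewrite (_ : (fun w => _) = fubini_F (distribution P Y') F \o X).
  exact: measurableT_comp mG mX.
apply/funext => w /=; rewrite /fubini_F ge0_integral_distribution//.
exact: measurable_fun_pair2.
Qed.

Hypothesis XY : forall A B, measurable A -> measurable B ->
  P (X @^-1` A `&` Y @^-1` B) = (P (X @^-1` A) * P (Y @^-1` B))%E.

(** By uniqueness of product measures the law of [(X, Y)] is the product of the
    laws of [X] and [Y]; the formula is Tonelli's theorem for it. *)
Lemma integral_indep_pair (F : T1 * T2 -> \bar R) :
  measurable_fun setT F -> (forall z, 0 <= F z)%E ->
  (\int[P]_w F (X w, Y w) = \int[P]_w \int[P]_w' F (X w, Y w'))%E.
Proof.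
move=> mF F0.
pose X' : {mfun T >-> T1} := HB.pack X (isMeasurableFun.Build _ _ _ _ _ mX).
pose Y' : {mfun T >-> T2} := HB.pack Y (isMeasurableFun.Build _ _ _ _ _ mY).
pose Z' : {mfun T >-> (T1 * T2)%type} := HB.pack Z (isMeasurableFun.Build _ _ _ _ _ mZ).
transitivity (\int[distribution P Z']_z F z)%E.
  by rewrite ge0_integral_distribution.
transitivity (\int[distribution P X' \x distribution P Y']_z F z)%E.
  apply: eq_measure_integral => /= A mA _.
  by apply/esym/product_measure_unique.
rewrite fubini_tonelli1//.
have mG := @measurable_fun_fubini_tonelli_F _ _ _ _ _ (distribution P Y') F mF F0.
rewrite ge0_integral_distribution//; last by move=> x; apply: integral_ge0.
apply: eq_integral => w _ /=.
rewrite /fubini_F ge0_integral_distribution//.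
exact: measurable_fun_pair2.
Qed.

End pairs.

(** * Borel structure of the space and independence of partial sums *)

Lemma continuous_borel_measurable (R : realType) (H : completeNormedModType R) (g : H -> R) :
  continuous g -> measurable_fun setT (g : borelType H -> R).
Proof.
move=> cg.
apply: (@measurability _ _ (borelType H) _ _ _ _ (RGenOpens.measurableE R)).
move=> _ [_ [a [b ->]] <-].
rewrite setTI; apply: sub_sigma_algebra.
by move/continuousP : cg; apply; exact: interval_open.
Qed.

(** The preimage of an open set under addition is open in the product topology;
    separability is what makes it a countable union of products of balls, so
    that it belongs to the product of the Borel sigma-algebras. *)
Lemma measurable_borel_add (R : realType) (H : completeNormedModType R) :
  separable_space H ->
  measurable_fun [set: (borelType H * borelType H)%type]
    (fun z => (z.1 + z.2 : borelType H)).
Proof.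
move=> [D [cD dD]].
apply: (@measurability _ _ (borelType H * borelType H)%type (borelType H) _ _ (@open H)).
  by [].
move=> _ [U oU <-]; rewrite setTI.
pose I := [set i : H * H * nat | [/\ D i.1.1, D i.1.2 &
  forall x y, ball i.1.1 i.2.+1%:R^-1 x -> ball i.1.2 i.2.+1%:R^-1 y -> U (x + y)]].
have cI : countable I.
  apply: (@sub_countable _ _ _ ((D `*` D) `*` [set: nat])).
    by apply: subset_card_le => -[[x y] m] [/= ? ? _].
  by apply: countableX => //; exact: countableX.
have ballM (x : H) (e : R) : measurable (ball x e : set (borelType H)).
  by apply: sub_sigma_algebra; exact: ball_open.
have -> : (fun z : borelType H * borelType H => (z.1 + z.2 : borelType H)) @^-1` U =
    \bigcup_(i in I) ((ball i.1.1 i.2.+1%:R^-1 : set (borelType H)) `*`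
                      (ball i.1.2 i.2.+1%:R^-1 : set (borelType H))).
  apply/seteqP; split=> [[x y] /= Uxy|[x y] [i [_ _ iU] [/= ix iy]]]; last exact: iU.
  have /nbhs_ballP[e /= e0 eU] : nbhs (x + y) U by exact: open_nbhs_nbhs.
  (* Four distances below [m.+1%:R^-1] will add up to less than [e]. *)
  have [m _ me] : \forall m \near \oo, m.+1%:R^-1 < e / 4.
    by apply: (near_infty_natSinv_lt (PosNum _)); rewrite divr_gt0.
  have m0 : 0 < m.+1%:R^-1 :> R by rewrite invr_gt0.
  have {}me : m.+1%:R^-1 < e / 4 by exact: (me m (leqnn m)).
  have near_ (z : H) : exists2 z', D z' & ball z' m.+1%:R^-1 z.
    have [z' [bz' Dz']] := dD (ball z m.+1%:R^-1) (ex_intro _ z (ballxx _ m0)) (ball_open _ _).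
    by exists z' => //; exact: ball_sym.
  have [x' Dx' xx'] := near_ x; have [y' Dy' yy'] := near_ y.
  exists ((x', y'), m) => //; split => //= a b xa yb; apply: eU.
  move: xx' yy' xa yb; rewrite -!ball_normE /= => xx' yy' xa yb.
  have k (u v w : H) : - (u - v) + (u - w) = v - w by rewrite opprB addrA subrK.
  rewrite (_ : x + y - (a + b) = (- (x' - x) + (x' - a)) + (- (y' - y) + (y' - b))); last first.
    by rewrite !k opprD addrACA.
  have h1 := ler_normD (- (x' - x) + (x' - a)) (- (y' - y) + (y' - b)).
  have h2 := ler_normD (- (x' - x)) (x' - a).
  have h3 := ler_normD (- (y' - y)) (y' - b).
  rewrite !normrN in h2 h3.
  apply: (le_lt_trans h1); apply: (le_lt_trans (lerD h2 h3)).
  move: (m.+1%:R^-1) me xx' yy' xa yb => r; lra.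
have [I0'|[g]] := pfcard_geP cI; first by rewrite I0' bigcup_set0.
have /surjfunPex[h ->] : $|{surjfun [set: nat] >-> I}| by exists.
rewrite bigcup_image; apply: bigcup_measurable => k _; exact: measurableX.
Qed.

(** Independence of [f k] from any event determined by finitely many later
    increments.  In the induction step such an event [E] is independent of the
    pair [(f k, increment f k.+1)], first on rectangles, where the event
    [increment f k.+1 \in C] can be absorbed into the family, then on all
    measurable sets of the product, among them the preimages under addition. *)
Lemma partial_sum_indep (R : realType) (H : completeNormedModType R)
    (d : measure_display) (T : measurableType d) (P : probability T R) (f : nat -> T -> H) :
  separable_space H -> M_ind P f ->
  (forall j, (1 <= j)%N -> random_vector (increment f j)) ->
  forall k (A : set (borelType H)) (J : {fset nat}) (B : nat -> set (borelType H)),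
  measurable A -> (forall j, j \in J -> (k < j)%N) -> (forall j, j \in J -> measurable (B j)) ->
  (P (f k @^-1` A `&` \bigcap_(j in [set` J]) (increment f j @^-1` B j)) =
   P (f k @^-1` A) * P (\bigcap_(j in [set` J]) (increment f j @^-1` B j)))%E.
Proof.
move=> sepH [f0 fint find] mI.
have mf k : measurable_fun setT (f k : T -> borelType H) by case: (fint k).
have mInc j (C : set (borelType H)) :
    (1 <= j)%N -> measurable C -> measurable (increment f j @^-1` C).
  by move=> j1 mC; rewrite -[X in measurable X]setTI; exact: mI.
elim=> [|k IH] A J B mA J1 mB.
  have [A0|A0] := pselect (A 0).
    have -> : f 0%N @^-1` A = setT by apply/seteqP; split => // w _; rewrite /= f0.
    by rewrite setTI probability_setT mul1e.
  have -> : f 0%N @^-1` A = set0 by apply/seteqP; split => // w; rewrite /= f0.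
  by rewrite set0I measure0 mul0e.
set E := \bigcap_(j in _) _.
have mE : measurable E.
  apply: fin_bigcap_measurable => // j jJ; apply: mInc; last exact: mB.
  exact: leq_trans (J1 _ jJ).
have kJ : k.+1 \notin J by apply/negP => /J1; rewrite ltnn.
pose B' (C : set (borelType H)) j := if j == k.+1 then C else B j.
have B'J C (j : nat) : j \in J -> B' C j = B j.
  by rewrite /B'; case: eqP => // -> kJ'; rewrite kJ' in kJ.
have capU C : \bigcap_(j in [set` (k.+1 |` J)%fset]) (increment f j @^-1` B' C j) =
    increment f k.+1 @^-1` C `&` E.
  rewrite set_fsetU1 bigcap_setU1 {1}/B' eqxx; congr (_ `&` _).
  by apply: eq_bigcapr => j /= jJ; rewrite B'J.
have mB' C j : measurable C -> j \in (k.+1 |` J)%fset -> measurable (B' C j).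
  move=> mC; rewrite in_fset1U /B' => /orP[/eqP ->|jJ]; first by rewrite eqxx.
  by case: ifP => // _; exact: mB.
have incE (C : set (borelType H)) : measurable C -> P (increment f k.+1 @^-1` C `&` E) =
    (P (increment f k.+1 @^-1` C) * P E)%E.
  move=> mC; rewrite -capU find; last 2 first.
  - by move=> j; rewrite in_fset1U => /orP[/eqP ->//|/J1 /= h]; exact: leq_trans h.
  - by move=> j; exact: mB'.
  rewrite big_fsetU1//= {1}/B' eqxx; congr (_ * _)%E.
  rewrite /E find//; last by move=> j /J1 /= h; exact: leq_trans h.
  by apply: eq_big_seq => j jJ; rewrite B'J.
have fincE (A' C : set (borelType H)) : measurable A' -> measurable C ->
    P (f k @^-1` A' `&` (increment f k.+1 @^-1` C `&` E)) =
    (P (f k @^-1` A') * P (increment f k.+1 @^-1` C `&` E))%E.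
  move=> mA' mC; rewrite -capU IH//.
  - by move=> j; rewrite in_fset1U => /orP[/eqP ->//|/J1 h]; exact: ltnW.
  - by move=> j; exact: mB'.
have finc (A' C : set (borelType H)) : measurable A' -> measurable C ->
    P (f k @^-1` A' `&` increment f k.+1 @^-1` C) =
    (P (f k @^-1` A') * P (increment f k.+1 @^-1` C))%E.
  move=> mA' mC; have := IH A' [fset k.+1]%fset (fun=> C) mA'.
  rewrite set_fset1 bigcap_set1; apply => //.
  by move=> j; rewrite inE => /eqP ->.
have := @pair_indep_rectangles _ _ _ _ _ _ _ P (f k : T -> borelType H)
  (increment f k.+1 : T -> borelType H) (mf k) (mI k.+1 isT) E mE _
  ((fun z => (z.1 + z.2 : borelType H)) @^-1` A).
have -> : (fun w => (f k w, increment f k.+1 w)) @^-1`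
    ((fun z => z.1 + z.2) @^-1` A) = f k.+1 @^-1` A.
  by apply/seteqP; split=> w /=; rewrite /increment addrC subrK.
apply.
  by move=> A' C mA' mC; rewrite -setIA fincE// incE// finc// muleA.
by rewrite -[X in measurable X]setTI; exact: (measurable_borel_add sepH).
Qed.

(** * Inner products and Bochner expectations *)

(** The Cauchy-Schwarz inequality is read off from the triangle inequality for
    [x + y] and [x - y]. *)
Lemma hilbert_dot (R : realType) (H : completeNormedModType R) : is_hilbert H ->
  exists dot : H -> H -> R, [/\ forall x, scalar (dot x),
    forall x y, `|x + y| ^+ 2 = `|x| ^+ 2 + 2 * dot x y + `|y| ^+ 2 &
    forall x y, `|dot x y| <= `|x| * `|y| ].
Proof.
move=> [dot dotE]; exists (fun x y => dot x y).
have dotxx x : `|x| ^+ 2 = dot x x.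
  rewrite dotE sqr_sqrtr//; have [->|x0] := eqVneq x 0; first by rewrite linear0l.
  exact/ltW/neq0_dnorm_gt0.
have expand x y : `|x + y| ^+ 2 = `|x| ^+ 2 + 2 * dot x y + `|y| ^+ 2.
  rewrite !dotxx hnormD /= expr0 mul1r; lra.
split=> //.
  by move=> x a u v; rewrite linearPr.
move=> x y; have nx := normr_ge0 x; have ny := normr_ge0 y.
have le (z : H) : `|x + z| ^+ 2 <= (`|x| + `|z|) ^+ 2.
  by rewrite ler_sqr ?nnegrE ?addr_ge0// ler_normD.
rewrite ler_norml; apply/andP; split.
  have := le (- y); rewrite expand normrN linearNr; nra.
have := le y; rewrite expand; nra.
Qed.

Lemma random_vectorB (R : realType) (H : completeNormedModType R)
    (d : measure_display) (T : measurableType d) (X Y : T -> H) :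
  separable_space H -> random_vector X -> random_vector Y ->
  random_vector (fun w => X w - Y w).
Proof.
move=> sepH mX mY.
have mN : measurable_fun setT (fun w => (- Y w : borelType H)).
  apply: (@measurability _ _ T (borelType H) _ _ (@open H)); first by [].
  move=> _ [U oU <-].
  apply: (mY measurableT (-%R @^-1` U)); apply: sub_sigma_algebra.
  by apply: open_comp => // x _; exact: opp_continuous.
exact: (measurableT_comp (measurable_borel_add sepH)
  (measurable_fun_pair (mX : measurable_fun setT (X : T -> borelType H)) mN)).
Qed.

(** Bounded linear functionals commute with the Bochner expectation: for simple
    vectors this is a finite sum, and both sides are continuous with respect to
    the convergence in mean of the simple approximations. *)
Lemma integral_functional (R : realType) (H : completeNormedModType R)
    (d : measure_display) (T : measurableType d) (P : probability T R)
    (X : T -> H) (v : H) (g : H -> R) (K : R) :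
  separable_space H -> scalar g -> 0 < K -> (forall y, `|g y| <= K * `|y|) ->
  has_expectation P X v ->
  P.-integrable setT (fun w => (g (X w))%:E) /\ (\int[P]_w (g (X w))%:E = (g v)%:E)%E.
Proof.
move=> sepH gl K0 gK [mX [s [ssim sX] sv]].
have gB x y : g (x - y) = g x - g y by rewrite addrC -scaleN1r gl mulN1r addrC.
have g0 : g 0 = 0 by have := gB 0 0; rewrite !subrr.
have gZ a x : g (a *: x) = a * g x by rewrite -[a *: x]addr0 gl g0 addr0.
have gD x y : g (x + y) = g x + g y by have := gl 1 x y; rewrite scale1r mul1r.
have cg : continuous g.
  move=> x; apply/cvgrPdist_lt => e e0; near=> y.
  rewrite -gB; apply: (le_lt_trans (gK _)); rewrite -ltr_pdivlMl// mulrC.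
  by near: y; apply: cvgr_dist_lt => //; rewrite divr_gt0.
have mg (Z : T -> H) : random_vector Z -> measurable_fun setT (fun w => g (Z w)).
  move=> mZ; exact: (measurableT_comp (continuous_borel_measurable cg) mZ).
have mn (Z : T -> H) : random_vector Z -> measurable_fun setT (fun w => `|Z w|).
  by move=> mZ; exact: (measurableT_comp (continuous_borel_measurable (@norm_continuous _ _)) mZ).
(* The case of a simple vector, from its decomposition over its values. *)
have simple_int Z : simple_vector Z -> P.-integrable setT (fun w => (g (Z w))%:E)
   /\ (\int[P]_w (g (Z w))%:E = (g (simple_expectation P Z))%:E)%E.
  move=> [mZ fZ].
  have mfib y : measurable (Z @^-1` [set y]).
    rewrite -[X in measurable X]setTI; apply: mZ => //.
    rewrite -(setCK [set y]); apply: measurableC; apply: sub_sigma_algebra.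
    rewrite openC; exact: accessible_closed_set1 (hausdorff_accessible (@norm_hausdorff _ _)) _.
  have gZw w : ((g (Z w))%:E =
      \sum_(y <- fset_set (range Z)) (g y)%:E * (\1_(Z @^-1` [set y]) w)%:E)%E.
    have Zw : Z w \in fset_set (range Z) by rewrite in_fset_set// inE; exists w.
    rewrite (bigD1_seq (Z w))//= ?fset_uniq// big1 ?adde0.
      by rewrite indicE mem_set// mule1.
    by move=> y yZ; rewrite indicE memNset ?mule0// => /= e; rewrite e eqxx in yZ.
  have ind y : P.-integrable setT (fun w => (g y)%:E * (\1_(Z @^-1` [set y]) w)%:E)%E.
    by apply: integrableZl => //; exact: integrable_indic.
  split.
    under eq_fun do rewrite gZw.
    by apply: integrable_sum => // y _; exact: ind.
  under eq_integral do rewrite gZw.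
  rewrite integral_sum//.
  transitivity (\sum_(y <- fset_set (range Z)) (fine (P (Z @^-1` [set y])) * g y)%:E)%E.
    apply: eq_bigr => y _; rewrite integralZl//; last exact: integrable_indic.
    by rewrite integral_indic// setIT EFinM fineK ?fin_num_measure// muleC.
  rewrite sumEFin /simple_expectation fsbig_finite//=; congr EFin.
  elim/big_ind2 : _ => //.
  by move=> a b c e -> ->; rewrite gD.
have mXs k : measurable_fun setT (fun w => `|X w - s k w|).
  apply: mn; apply: random_vectorB => //; exact: (ssim k).1.
have le_g k w : `|g (X w) - g (s k w)| <= K * `|X w - s k w| by rewrite -gB.
have mdiff k : measurable_fun setT (fun w => (g (X w))%:E + (- g (s k w))%:E)%E.
  under eq_fun do rewrite -EFinD.
  by apply/measurable_EFinP; apply: measurable_funB; apply: mg => //; exact: (ssim k).1.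
have int_dist k : ((\int[P]_w `|X w - s k w|%:E) < +oo ->
    P.-integrable setT (fun w => (g (X w) - g (s k w))%:E))%E.
  move=> fink; apply: (@le_integrable _ _ _ _ _ _ _ (fun w => K%:E * `|X w - s k w|%:E)%E) => //.
  - by apply/measurable_EFinP; apply: measurable_funB; apply: mg => //; exact: (ssim k).1.
  - move=> w _; rewrite -EFinM !abse_EFin lee_fin; apply: (le_trans (le_g k w)).
    by rewrite ger0_norm// mulr_ge0// ltW.
  apply: integrableZl => //; apply/integrableP; split; first exact/measurable_EFinP.
  by under eq_integral do rewrite abse_EFin normr_id.
have ev (e : R) : 0 < e -> \forall k \near \oo, (\int[P]_w `|X w - s k w|%:E < e%:E)%E.
  move=> e0; move/fine_cvgP : sX => [fin_ cv_].
  near=> k; have -> : (\int[P]_w `|X w - s k w|%:E =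
      (fine (\int[P]_w `|X w - s k w|%:E))%:E)%E by rewrite fineK//; near: k.
  rewrite lte_fin -[X in X < _]subr0; apply: le_lt_trans (ler_norm _) _.
  by near: k; apply: cvgr_distC_lt.
have intX : P.-integrable setT (fun w => (g (X w))%:E).
  have [k _ /(_ k (leqnn k)) h] := ev 1 ltr01.
  have -> : (fun w => (g (X w))%:E) = (fun w => (g (X w) - g (s k w))%:E + (g (s k w))%:E)%E.
    by apply/funext => w; rewrite -EFinD subrK.
  apply: integrableD => //; last exact: (simple_int _ (ssim k)).1.
  by apply: int_dist; apply: (lt_trans h); rewrite ltry.
split=> //.
have fI : (\int[P]_w (g (X w))%:E)%E \is a fin_num by exact: integrable_fin_num.
rewrite -(fineK fI); congr EFin; apply/eqP; rewrite -subr_eq0 -normr_le0.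
apply/ler_addgt0Pr => e e0; rewrite add0r.
have e2 : 0 < e / (2 * K) by rewrite divr_gt0// mulr_gt0.
near \oo => k.
have hk : (\int[P]_w `|X w - s k w|%:E < (e / (2 * K))%:E)%E by near: k; exact: ev.
have hv : `|v - simple_expectation P (s k)| < e / (2 * K).
  by near: k; move/cvgrPdist_lt : sv; apply.
have [ik ike] := simple_int _ (ssim k).
have e1 : `|fine (\int[P]_w (g (X w))%:E) - g (simple_expectation P (s k))| <= e / 2.
  rewrite -lee_fin -abse_EFin EFinB fineK// -ike -integralB//=.
  apply: (le_trans (le_abse_integral _ _ _)) => //.
  apply: (@le_trans _ _ (K%:E * \int[P]_w `|X w - s k w|%:E)%E).
    have mXsE : measurable_fun setT (fun w => `|X w - s k w|%:E) by exact/measurable_EFinP.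
    rewrite -ge0_integralZl// ?lee_fin ?(ltW K0)//.
    apply: ge0_le_integral => //.
    - by apply: measurableT_comp => //; exact: mdiff.
    - by apply: measurable_funeM; exact/measurable_EFinP.
    - by move=> w _; rewrite -EFinB abse_EFin -EFinM lee_fin.
  rewrite muleC -lee_pdivlMr// -EFinM; apply/ltW/(lt_le_trans hk).
  by rewrite lee_fin -mulrA -invfM.
have e3 : `|g (simple_expectation P (s k)) - g v| <= e / 2.
  rewrite distrC -gB; apply: (le_trans (gK _)).
  rewrite -ler_pdivlMl// mulrC -mulrA -invfM ltW//.
rewrite (splitr e); apply: le_trans (lerD e1 e3).
by rewrite -[X in `|X| <= _](subrKA (g (simple_expectation P (s k)))) ler_normD.
Unshelve. all: end_near.
Qed.

(** * One step of the moment recursion *)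

Section one_step.
Context (R : realType) (H : completeNormedModType R).
Hypotheses (sepH : separable_space H) (hilH : is_hilbert H).
Context (d : measure_display) (T : measurableType d) (P : probability T R).

Lemma measurable_norm_powR (X : T -> H) (p : R) : random_vector X ->
  measurable_fun setT (fun w => (`|X w| `^ p)%:E).
Proof.
move=> mX; apply/measurable_EFinP.
apply: (measurableT_comp (measurable_powR _)).
exact: (measurableT_comp (continuous_borel_measurable (@norm_continuous _ _)) mX).
Qed.

Lemma integral_probability_cst (r : R) : (\int[P]_w r%:E = r%:E)%E.
Proof.
rewrite integral_cst// -[RHS]mule1; congr (_ * _)%E; exact: probability_setT.
Qed.

(** Expectation of the pointwise expansion at a fixed [x]: the linear term is the
    value at [D] of the bounded functional [dot x], so it averages to 0. *)
Lemma shifted_moment_le (D : T -> H) (p c l b2 ap : R) (x : H) :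
  2 <= p -> 1 <= c -> 0 < l -> has_expectation P D 0 ->
  (\int[P]_w (`|D w| `^ 2)%:E = b2%:E)%E ->
  (\int[P]_w (`|D w| `^ p)%:E = ap%:E)%E ->
  (\int[P]_w (`|x + D w| `^ p)%:E <=
   (`|x| `^ p + quad_coef p c * (`|x| `^ p / l ^+ 2 + l `^ (p - 2)) * b2
     + pow_coef p c * ap)%:E)%E.
Proof.
move=> p2 c1 l0 ED b2E apE.
have [dot [dotl dot_expand dotCS]] := hilbert_dot hilH.
have mD : random_vector D by case: ED.
have mxD : random_vector (fun w => x + D w).
  exact: (measurableT_comp (measurable_borel_add sepH) (measurable_fun_pair
    (measurable_cst (x : borelType H)) (mD : measurable_fun setT (D : T -> borelType H)))).
have K0 : 0 < `|x| + 1 by rewrite ltr_wpDl.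
have dotK y : `|dot x y| <= (`|x| + 1) * `|y|.
  by apply: (le_trans (dotCS x y)); rewrite ler_wpM2r// lerDl.
have [int_dot dot0] := integral_functional sepH (dotl x) K0 dotK ED.
have {}dot0 : (\int[P]_w (dot x (D w))%:E = 0)%E.
  by rewrite dot0; have := dotCS x 0; rewrite normr0 mulr0 normr_le0 => /eqP ->.
have int_pow r s : (\int[P]_w (`|D w| `^ r)%:E = s%:E)%E ->
    P.-integrable setT (fun w => (`|D w| `^ r)%:E).
  move=> rE; apply/integrableP; split; first exact: measurable_norm_powR.
  rewrite (eq_integral (fun w => (`|D w| `^ r)%:E)); first by rewrite rE ltry.
  by move=> w _; rewrite gee0_abs// lee_fin powR_ge0.
have i2 := int_pow _ _ b2E; have ip := int_pow _ _ apE.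
set u := quad_coef p c; set v := pow_coef p c.
set K := u * (`|x| `^ p / l ^+ 2 + l `^ (p - 2)).
pose F w := ((`|x| `^ p)%:E + (p * `|x| `^ (p - 2))%:E * (dot x (D w))%:E +
  K%:E * (`|D w| `^ 2)%:E + v%:E * (`|D w| `^ p)%:E)%E.
have iF1 : P.-integrable setT (fun=> (`|x| `^ p)%:E) by exact: finite_measure_integrable_cst.
have iF2 : P.-integrable setT (fun w => (p * `|x| `^ (p - 2))%:E * (dot x (D w))%:E)%E.
  exact: integrableZl.
have iF3 : P.-integrable setT (fun w => K%:E * (`|D w| `^ 2)%:E)%E by exact: integrableZl.
have iF4 : P.-integrable setT (fun w => v%:E * (`|D w| `^ p)%:E)%E by exact: integrableZl.
have iF12 := integrableD measurableT iF1 iF2.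
have iF123 := integrableD measurableT iF12 iF3.
have iF := integrableD measurableT iF123 iF4.
apply: (@le_trans _ _ (\int[P]_w F w)%E).
  apply: ge0_le_integral => //.
  - exact: measurable_norm_powR.
  - exact: (measurable_int _ iF).
  - move=> w _; rewrite /F -!EFinM -!EFinD lee_fin.
    rewrite powR_mulrn//; apply: powR_one_step => //.
    by apply: (le_trans (ler_dist_dist _ _)); rewrite addrAC subrr add0r.
rewrite /F integralD// integralD// integralD// !integralZl//.
rewrite dot0 mule0 adde0 b2E apE.
by rewrite integral_probability_cst -!EFinM -!EFinD.
Qed.

(** One step of the moment recursion: by independence the variable [X] may be
    frozen while [D] is integrated, which is the previous lemma. *)
Lemma indep_sum_moment_le (X D : T -> H) (p c l b2 ap : R) :
  2 <= p -> 1 <= c -> 0 < l -> random_vector X -> has_expectation P D 0 ->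
  (forall A B : set (borelType H), measurable A -> measurable B ->
    P (X @^-1` A `&` D @^-1` B) = (P (X @^-1` A) * P (D @^-1` B))%E) ->
  (\int[P]_w (`|D w| `^ 2)%:E = b2%:E)%E ->
  (\int[P]_w (`|D w| `^ p)%:E = ap%:E)%E ->
  (\int[P]_w (`|X w + D w| `^ p)%:E <=
   (1 + quad_coef p c * b2 / l ^+ 2)%:E * \int[P]_w (`|X w| `^ p)%:E +
   (quad_coef p c * l `^ (p - 2) * b2 + pow_coef p c * ap)%:E)%E.
Proof.
move=> p2 c1 l0 mX ED XD b2E apE.
have mD : random_vector D by case: ED.
pose F (z : borelType H * borelType H) := (`|(z.1 + z.2 : H)| `^ p)%:E.
have mF : measurable_fun setT F.
  apply/measurable_EFinP; apply: (measurableT_comp (measurable_powR _)).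
  exact: (measurableT_comp (continuous_borel_measurable (@norm_continuous _ _))
    (measurable_borel_add sepH)).
have F0 z : (0 <= F z)%E by rewrite lee_fin powR_ge0.
have := integral_indep_pair (mX : measurable_fun setT (X : T -> borelType H))
  (mD : measurable_fun setT (D : T -> borelType H)) XD mF F0.
rewrite /F /= => ->.
have b0 : 0 <= b2 by rewrite -lee_fin -b2E integral_ge0// => w _; rewrite lee_fin powR_ge0.
have a0 : 0 <= ap by rewrite -lee_fin -apE integral_ge0// => w _; rewrite lee_fin powR_ge0.
have u0 : 0 <= quad_coef p c by rewrite mulr_ge0 ?sqr_ge0 ?expR_ge0.
have v0 : 0 <= pow_coef p c by rewrite mulr_ge0 ?sqr_ge0 ?powR_ge0.
have k0 : 0 <= 1 + quad_coef p c * b2 / l ^+ 2.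
  by apply: addr_ge0 => //; apply: divr_ge0; [exact: mulr_ge0|exact: sqr_ge0].
have mXp := measurable_norm_powR p mX.
apply: (@le_trans _ _ (\int[P]_w ((1 + quad_coef p c * b2 / l ^+ 2)%:E * (`|X w| `^ p)%:E +
   (quad_coef p c * l `^ (p - 2) * b2 + pow_coef p c * ap)%:E))%E).
  apply: ge0_le_integral => //.
  - by move=> w _; exact: integral_ge0.
  - exact: (measurable_section_integral P (mX : measurable_fun setT (X : T -> borelType H))
      (mD : measurable_fun setT (D : T -> borelType H)) mF F0).
  - by apply: emeasurable_funD => //; exact: measurable_funeM.
  - move=> w _; apply: (le_trans (shifted_moment_le _ p2 c1 l0 ED b2E apE)).
    rewrite -EFinM -EFinD lee_fin le_eqVlt; apply/orP; left; apply/eqP; ring.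
rewrite ge0_integralD//.
- by rewrite ge0_integralZl// integral_probability_cst.
- by move=> w _; rewrite mule_ge0// lee_fin ?powR_ge0.
- exact: measurable_funeM.
- move=> w _; rewrite lee_fin; apply: addr_ge0; apply: mulr_ge0 => //.
  by apply: mulr_ge0 => //; exact: powR_ge0.
Qed.

End one_step.

(** * Moments of the partial sums *)

Section moments.
Context (R : realType) (H : completeNormedModType R).
Hypotheses (sepH : separable_space H) (hilH : is_hilbert H).
Context (d : measure_display) (T : measurableType d) (P : probability T R).
Variable f : nat -> T -> H.
Hypotheses (Mf : M_ind P f)
  (Ef : forall j, (1 <= j)%N -> has_expectation P (increment f j) 0).

(** Discrete Gronwall argument for the one-step recursion, based on
    [1 + x <= expR x]. *)
Lemma partial_sum_moment_le (p c l : R) (b a : nat -> R) (n : nat) :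
  2 <= p -> 1 <= c -> 0 < l ->
  (forall j, (1 <= j <= n)%N -> \int[P]_w (`|increment f j w| `^ 2)%:E = (b j)%:E)%E ->
  (forall j, (1 <= j <= n)%N -> \int[P]_w (`|increment f j w| `^ p)%:E = (a j)%:E)%E ->
  (\int[P]_w (`|f n w| `^ p)%:E <=
   (expR (quad_coef p c * (\sum_(1 <= j < n.+1) b j) / l ^+ 2) *
    (quad_coef p c * l `^ (p - 2) * (\sum_(1 <= j < n.+1) b j) +
     pow_coef p c * (\sum_(1 <= j < n.+1) a j)))%:E)%E.
Proof.
move=> p2 c1 l0; have p0 : p != 0 by rewrite gt_eqF; lra.
have u0 : 0 <= quad_coef p c by apply: mulr_ge0; rewrite ?sqr_ge0 ?expR_ge0.
have v0 : 0 <= pow_coef p c by apply: mulr_ge0; rewrite ?sqr_ge0 ?powR_ge0.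
have [f0 fint _] := Mf.
elim: n => [|n IH] bE aE.
  rewrite !big_geq// !mulr0 addr0 mulr0 integral0_eq// => w _.
  by rewrite f0 normr0 powR0.
have moment_ge0 r s j : (\int[P]_w (`|increment f j w| `^ r)%:E = s%:E)%E -> 0 <= s.
  by move=> rE; rewrite -lee_fin -rE integral_ge0// => w _; rewrite lee_fin powR_ge0.
have wid j : (1 <= j <= n)%N -> (1 <= j <= n.+1)%N by move=> /andP[-> /leqW].
have {}IH := IH (fun j jn => bE j (wid j jn)) (fun j jn => aE j (wid j jn)).
have recr (g : nat -> R) : \sum_(1 <= j < n.+2) g j = \sum_(1 <= j < n.+1) g j + g n.+1.
  by rewrite big_nat_recr.
rewrite !recr.
set B := \sum_(1 <= j < n.+1) b j in IH *; set V := \sum_(1 <= j < n.+1) a j in IH *.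
have B0 : 0 <= B.
  by rewrite /B big_nat_cond sumr_ge0// => j /andP[/wid jn _]; exact: moment_ge0 (bE _ jn).
have V0 : 0 <= V.
  by rewrite /V big_nat_cond sumr_ge0// => j /andP[/wid jn _]; exact: moment_ge0 (aE _ jn).
have last_ : (1 <= n.+1 <= n.+1)%N by rewrite leqnn.
have bn := bE _ last_; have an := aE _ last_.
have b0 := moment_ge0 _ _ _ bn; have a0 := moment_ge0 _ _ _ an.
have fn : f n.+1 = fun w => f n w + increment f n.+1 w.
  by apply/funext => w; rewrite /increment addrC subrK.
have ind (A C : set (borelType H)) : measurable A -> measurable C ->
    P (f n @^-1` A `&` increment f n.+1 @^-1` C) =
    (P (f n @^-1` A) * P (increment f n.+1 @^-1` C))%E.
  move=> mA mC; have := @partial_sum_indep _ _ _ _ P f sepH Mf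
    (fun j j1 => (Ef j1).1) n A [fset n.+1]%fset (fun=> C) mA.
  rewrite set_fset1 bigcap_set1; apply => //.
  by move=> j; rewrite inE => /eqP ->.
rewrite [in leLHS]fn.
apply: (le_trans (indep_sum_moment_le sepH hilH p2 c1 l0 (fint n).1 (Ef _) ind bn an)) => //.
set u := quad_coef p c in u0 IH *; set v := pow_coef p c in v0 IH *.
set x := u * b n.+1 / l ^+ 2.
have x0 : 0 <= x by apply: divr_ge0; [exact: mulr_ge0|exact: sqr_ge0].
set E := expR (u * B / l ^+ 2) in IH *.
apply: (@le_trans _ _ ((1 + x)%:E * (E * (u * l `^ (p - 2) * B + v * V))%:E +
   (u * l `^ (p - 2) * b n.+1 + v * a n.+1)%:E)%E).
  by rewrite leeD2r// lee_wpmul2l// lee_fin; lra.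
rewrite -EFinM -EFinD lee_fin.
rewrite (_ : u * (B + b n.+1) / l ^+ 2 = u * B / l ^+ 2 + x); last by rewrite /x mulrDr mulrDl.
rewrite expRD -/E.
have E1 : 1 <= E.
  by rewrite -expR0 ler_expR; apply: divr_ge0; [exact: mulr_ge0|exact: sqr_ge0].
have ex := expR_ge1Dx x.
have lq := powR_ge0 l (p - 2).
set Y := u * l `^ (p - 2) * B + v * V; set y := u * l `^ (p - 2) * b n.+1 + v * a n.+1.
have Y0 : 0 <= Y by apply: addr_ge0; do 2?apply: mulr_ge0 => //.
have y0 : 0 <= y by apply: addr_ge0; do 2?apply: mulr_ge0 => //.
rewrite (_ : u * l `^ (p - 2) * (B + b n.+1) + v * (V + a n.+1) = Y + y); last first.
  by rewrite /Y /y; ring.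
rewrite [E * expR x * (Y + y)]mulrDr; apply: lerD.
  by rewrite mulrA ler_wpM2r// mulrC ler_wpM2l// ltW// (lt_le_trans ltr01).
rewrite ler_peMl// -[1]mulr1 ler_pM//; lra.
Qed.

(** The power [q] of the norm on the right is the integral of the full series of
    the [q]-th powers of the increments. *)
Lemma moments_le_Lnorm_S (q : R) (n : nat) : 0 < q ->
  (\sum_(1 <= j < n.+1) \int[P]_w (`|increment f j w| `^ q)%:E <=
   'N[P]_q%:E [S_ f q] `^ q)%E.
Proof.
move=> q0.
have mIp j : measurable_fun setT (fun w => (`|increment f j w| `^ q)%:E).
  case: j => [|j]; last by apply: measurable_norm_powR; case: (Ef (ltn0Sn j)).
  by rewrite /increment; under eq_fun do rewrite subrr normr0; exact: measurable_cst.
have p0 j w : (0 <= (`|increment f j w| `^ q)%:E)%E by rewrite lee_fin powR_ge0.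
rewrite poweR_Lnorm ?gt_eqF//.
have SE w : (`|S_ f q w| `^ q = \sum_(1 <= j <oo) (`|increment f j w| `^ q)%:E)%E.
  have s0 : (0 <= \sum_(1 <= j <oo) (`|increment f j w| `^ q)%:E)%E.
    by apply: nneseries_ge0 => j _ _; exact: p0.
  by rewrite /S_ gee0_abs ?poweR_ge0// -poweRrM mulVf ?gt_eqF// poweRe1.
under eq_integral do rewrite SE.
rewrite -ge0_integral_sum//; apply: ge0_le_integral => //.
- by move=> w _; apply: sume_ge0.
- exact: emeasurable_sum.
- under eq_fun do rewrite eseries_cond.
  by apply: ge0_emeasurable_sum => // j _; exact: mIp.
- by move=> w _; apply: nneseries_lim_ge => j _ _; exact: p0.
Qed.
End moments.

(** * Constants *)

Section constants.
Context {R : realType}.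
Implicit Types (p c l y t : R).

Lemma le_expR (x : R) : x <= expR x.
Proof. by apply: le_trans (expR_ge1Dx x); rewrite lerDr. Qed.

Lemma powR_superadd p x y : 1 <= p -> 0 <= x -> 0 <= y ->
  x `^ p + y `^ p <= (x + y) `^ p.
Proof.
move=> p1 x0 y0; have p0 : 0 < p by lra.
have s0 : 0 <= x + y by exact: addr_ge0.
rewrite -(mulr_powRB1 s0 p0) -(mulr_powRB1 x0 p0) -(mulr_powRB1 y0 p0) mulrDl.
by apply: lerD; apply: ler_wpM2l => //; apply: ge0_ler_powR; rewrite ?nnegrE//; lra.
Qed.

(** Extraction of the [p]-th root.  The condition on [l] says that
    [u s^2 / l^2 <= p / 2] for u = [quad_coef p c].  All factors that depend on
    [p] alone are then at most [e ^ (p / 2)] and [p ^ 2 <= e ^ (2 p)], which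
    accounts for the constant [expR (5 / 2)]. *)
Lemma moment_bound_le p c l y s : 2 <= p -> 1 <= c -> 0 < l -> 0 <= y -> 0 <= s ->
  2 * p * expR (p / c) * s ^+ 2 <= l ^+ 2 ->
  expR (quad_coef p c * s ^+ 2 / l ^+ 2) *
    (quad_coef p c * l `^ (p - 2) * s ^+ 2 + pow_coef p c * y `^ p)
  <= (expR (5 / 2) * (l + 2 * c * y)) `^ p.
Proof.
move=> p2 c1 l0 y0 s0 hl.
have l20 : 0 < l ^+ 2 by rewrite exprn_gt0.
have us : quad_coef p c * s ^+ 2 <= p / 2 * l ^+ 2.
  rewrite /quad_coef (_ : _ * _ = p / 2 * (2 * p * expR (p / c) * s ^+ 2)); last by field.
  by apply: ler_wpM2l => //; lra.
have u0 : 0 <= quad_coef p c * s ^+ 2.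
  by apply: mulr_ge0; rewrite ?sqr_ge0//; apply: mulr_ge0; rewrite ?sqr_ge0 ?expR_ge0.
have lq := powR_ge0 l (p - 2); have yp := powR_ge0 y p.
have lp : l `^ p = l `^ (p - 2) * l ^+ 2.
  by rewrite -powRD2 ?subrK//; [exact: ltW|lra].
have p1 : p ^+ 2 <= expR (p * 2).
  by rewrite expRM powR_mulrn ?expR_ge0// ler_sqr ?nnegrE ?expR_ge0 ?le_expR//; lra.
have E1 : expR (quad_coef p c * s ^+ 2 / l ^+ 2) <= expR (p / 2).
  by rewrite ler_expR ler_pdivrMr.
have c2 : (2 * c) `^ (p - 2) <= (2 * c) `^ p by apply: ler_powR; lra.
have inner : quad_coef p c * l `^ (p - 2) * s ^+ 2 + pow_coef p c * y `^ p <=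
    p ^+ 2 * (l + 2 * c * y) `^ p.
  apply: (@le_trans _ _ (p ^+ 2 * (l `^ p + (2 * c * y) `^ p))); last first.
    by apply: ler_wpM2l; rewrite ?sqr_ge0// powR_superadd// ?mulr_ge0//; lra.
  rewrite mulrDr; apply: lerD.
    rewrite [leLHS]mulrAC [leLHS]mulrC lp [leRHS]mulrCA; apply: ler_wpM2l => //.
    by apply: (le_trans us); apply: ler_wpM2r; [exact: ltW|nra].
  rewrite /pow_coef -mulrA; apply: ler_wpM2l; first exact: sqr_ge0.
  by rewrite [leRHS]powRM//; [exact: ler_wpM2r c2|lra].
apply: (le_trans (ler_pM _ _ E1 inner)); rewrite ?expR_ge0//.
  apply: addr_ge0; first by rewrite mulrAC mulr_ge0.
  by apply: mulr_ge0 => //; apply: mulr_ge0; rewrite ?sqr_ge0 ?powR_ge0.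
have L0 : 0 <= l + 2 * c * y by apply: addr_ge0; rewrite ?mulr_ge0//; lra.
rewrite powRM ?expR_ge0// mulrA -expRM.
apply: ler_wpM2r; first exact: powR_ge0.
rewrite (_ : 5 / 2 * p = p / 2 + p * 2); last by field.
by rewrite expRD ler_wpM2l ?expR_ge0.
Qed.

End constants.

(** * The inequality with a free parameter *)

Section main_bound.
Context (R : realType) (H : completeNormedModType R).
Hypotheses (sepH : separable_space H) (hilH : is_hilbert H).
Context (d : measure_display) (T : measurableType d) (P : probability T R).
Variable f : nat -> T -> H.
Hypotheses (Mf : M_ind P f)
  (Ef : forall j, (1 <= j)%N -> has_expectation P (increment f j) 0).

(** Once the norm of [S_ f q] is finite, the moments of the increments are real
    numbers with the expected bound on their sum. *)
Lemma increment_moments_fin (q y : R) (n : nat) : 0 < q ->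
  ('N[P]_q%:E [S_ f q] = y%:E)%E ->
  exists a : nat -> R,
    (forall j, (1 <= j <= n)%N -> (\int[P]_w (`|increment f j w| `^ q)%:E = (a j)%:E)%E) /\
    0 <= \sum_(1 <= j < n.+1) a j <= y `^ q.
Proof.
move=> q0 yE; have := moments_le_Lnorm_S Ef n q0.
rewrite yE poweR_EFin; set I := fun j => (\int[P]_w (`|increment f j w| `^ q)%:E)%E => le.
have I0 j : (0 <= I j)%E by apply: integral_ge0 => w _; rewrite lee_fin powR_ge0.
have IE j : (1 <= j <= n)%N -> I j = (fine (I j))%:E.
  move=> jn; rewrite fineK// ge0_fin_numE//; apply: le_lt_trans (ltry (y `^ q)).
  apply: le_trans le; rewrite (bigD1_seq j) ?iota_uniq ?mem_index_iota//=.
  by apply: leeDl; apply: sume_ge0 => i _; exact: I0.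
exists (fun j => fine (I j)); split=> //.
rewrite sumr_ge0/=; last by move=> j _; exact: fine_ge0.
rewrite -lee_fin -sumEFin; apply: le_trans le.
rewrite big_nat_cond [leRHS]big_nat_cond le_eqVlt; apply/orP; left; apply/eqP.
by apply: eq_bigr => j /andP[jn _]; rewrite -IE.
Qed.

(** The inequality with the free parameter [c], with an explicit constant. *)
Lemma Lnorm_partial_sum_le (p c : R) (n : nat) : 2 <= p -> 1 <= c <= p ->
  ('N[P]_p%:E [(fun w => (`|f n w|)%:E)] <=
   (2 * expR (5 / 2))%:E * (c%:E * 'N[P]_p%:E [S_ f p] +
     (Num.sqrt c * expR (p / c))%:E * 'N[P]_2%:E [S_ f 2]))%E.
Proof.
move=> p2 /andP[c1 cp]; have c0 : 0 < c by lra.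
have p0 : 0 < p by lra.
have k0 : 0 < Num.sqrt c * expR (p / c) by rewrite mulr_gt0 ?sqrtr_gt0 ?expR_gt0.
have A0 : 0 < 2 * expR (5 / 2) :> R by rewrite mulr_gt0 ?expR_gt0.
have Np0 := Lnorm_ge0 P p%:E (S_ f p); have N20 := Lnorm_ge0 P 2%:E (S_ f 2).
case EN2 : ('N[P]_2%:E [S_ f 2])%E N20 => [s| |]//; last first.
  rewrite gt0_muley ?lte_fin// addey ?gt0_muley ?leey ?lte_fin//.
  by rewrite -ltNye (lt_le_trans (ltNyr 0))// mule_ge0 ?lee_fin// ltW.
case ENp : ('N[P]_p%:E [S_ f p])%E Np0 => [y| |]//; last first.
  by rewrite gt0_muley ?lte_fin// addye ?gt0_muley ?leey ?lte_fin.
rewrite !lee_fin => y0 s0.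
have [a [aE /andP[a0 ay]]] := increment_moments_fin n p0 ENp.
have [b [bE /andP[b0 bs]]] := increment_moments_fin n (ltr0n R 2) EN2.
rewrite powR_mulrn// in bs.
(* The recursion needs [l > 0] even if the norm [s] of [S_ f 2] vanishes; hence
   the extra [e / K] in [l], which costs [e] in the end. *)
apply/lee_addgt0Pr => e e0.
pose K : R := expR (5 / 2); have K0 : 0 < K by exact: expR_gt0.
pose l := 2 * (Num.sqrt c * expR (p / c)) * s + e / K.
have eK : 0 < e / K by rewrite divr_gt0.
have ks0 : 0 <= 2 * (Num.sqrt c * expR (p / c)) * s by rewrite mulr_ge0// mulr_ge0// ltW.
have l0 : 0 < l by rewrite /l ltr_wpDl.
have hl : 2 * p * expR (p / c) * s ^+ 2 <= l ^+ 2.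
  apply: (@le_trans _ _ ((2 * (Num.sqrt c * expR (p / c)) * s) ^+ 2)); last first.
    by rewrite ler_sqr ?nnegrE ?(ltW l0)// /l lerDl ltW.
  rewrite !exprMn (sqr_sqrtr (ltW c0)). apply: ler_wpM2r; first exact: sqr_ge0.
  have := le_expR (p / c); rewrite ler_pdivrMr// => pc.
  have X0 := expR_ge0 (p / c); set X := expR (p / c) in pc X0 *.
  have := ler_wpM2r X0 pc; rewrite expr2 => h1.
  have h2 : 0 <= p * X by rewrite mulr_ge0// ltW.
  nra.
have := partial_sum_moment_le sepH hilH Mf Ef p2 c1 l0 bE aE.
set B := \sum_(1 <= j < n.+1) b j in b0 bs *; set V := \sum_(1 <= j < n.+1) a j in a0 ay *.
have u0 : 0 <= quad_coef p c by apply: mulr_ge0; rewrite ?sqr_ge0 ?expR_ge0.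
have v0 : 0 <= pow_coef p c by apply: mulr_ge0; rewrite ?sqr_ge0 ?powR_ge0.
have uB : quad_coef p c * B <= quad_coef p c * s ^+ 2 by exact: ler_wpM2l.
move=> moment.
have {}moment : (\int[P]_w (`|f n w| `^ p)%:E <= ((K * (l + 2 * c * y)) `^ p)%:E)%E.
  apply: (le_trans moment); rewrite lee_fin.
  apply: le_trans (moment_bound_le p2 c1 l0 y0 s0 hl).
  apply: ler_pM; rewrite ?expR_ge0//.
  - by apply: addr_ge0; repeat apply: mulr_ge0 => //; exact: powR_ge0.
  - by rewrite ler_expR ler_wpM2r// invr_ge0 sqr_ge0.
  - apply: lerD; last exact: ler_wpM2l.
    by apply: ler_wpM2l => //; apply: mulr_ge0 => //; exact: powR_ge0.
have L0 : 0 <= K * (l + 2 * c * y).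
  by rewrite mulr_ge0 ?ltW// ltr_wpDr// !mulr_ge0// ltW.
rewrite unlock /=.
under eq_integral do rewrite normr_id.
apply: (@le_trans _ _ (((K * (l + 2 * c * y)) `^ p)%:E `^ p^-1)%E).
  apply: gt0_ler_poweR => //; rewrite ?invr_ge0 ?ltW//.
  - rewrite in_itv/= leey andbT; apply: integral_ge0 => w _.
    by rewrite lee_fin powR_ge0.
  - by rewrite in_itv/= leey andbT lee_fin powR_ge0.
rewrite poweR_EFin -powRrM mulfV ?gt_eqF// powRr1// -!EFinM -!EFinD lee_fin.
rewrite le_eqVlt; apply/orP; left; apply/eqP; rewrite -/K /l; field.
by rewrite gt_eqF.
Qed.

End main_bound.

(** * Choices of the parameter and the theorem *)

Section choices_of_c.
Context {R : realType}.
Implicit Types p c alpha : R.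

Lemma expR1_ge2 : 2 <= expR 1 :> R.
Proof. by have := expR_ge1Dx (1 : R). Qed.

Lemma sqrt_expR_le p (x y : R) : 0 <= x -> 0 <= y -> x * expR (2 * p) <= y ^+ 2 ->
  Num.sqrt x * expR p <= y.
Proof.
move=> x0 y0 h; rewrite -ler_sqr ?nnegrE ?mulr_ge0 ?sqrtr_ge0 ?expR_ge0//.
by rewrite exprMn sqr_sqrtr// expr2 -expRD -mulr2n -mulr_natl.
Qed.

(** With [c = 4 p / ln p] the exponential is only [p `^ (1 / 4)], so that
    [sqrt c * expR (p / c)] stays below a multiple of [p / ln p]; the constant 4
    leaves room for the factor [sqrt c].  If this [c] exceeds [p], then [ln p] is
    bounded and [c = p] works. *)
Lemma choice_p_over_ln p : 2 <= p -> exists c, [/\ 1 <= c <= p,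
  c <= 4 * expR 1 * (p / ln p) &
  Num.sqrt c * expR (p / c) <= 4 * expR 1 * (p / ln p)].
Proof.
move=> p2; have p0 : 0 < p by lra.
have e2 := expR1_ge2.
have L0 : 0 < ln p by apply: ln_gt0; lra.
have pE : p = expR (ln p) by rewrite lnK// posrE.
have Lp : ln p <= p by apply/ltW/ln_sublinear.
have hL : ln p / 2 <= expR (ln p / 2) := le_expR _.
set E := expR (ln p / 2) in hL.
have EE : p = E * E by rewrite -expRD -splitr.
have E0 : 0 < E by exact: expR_gt0.
have pL1 : 1 <= p / ln p by rewrite ler_pdivlMr// mul1r.
have [cp|cp] := leP (4 * (p / ln p)) p.
  exists (4 * (p / ln p)); split; first by apply/andP; split => //; lra.
    by apply: ler_wpM2r; lra.
  apply: (@le_trans _ _ (4 * (p / ln p))); last by apply: ler_wpM2r; lra.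
  apply: sqrt_expR_le; [lra|lra|].
  have -> : 2 * (p / (4 * (p / ln p))) = ln p / 2 by field; rewrite !gt_eqF.
  rewrite -/E expr2 ler_wpM2l//; first lra.
  rewrite [4 * _]mulrA ler_pdivlMr//.
  have := ler_wpM2l (ltW E0) hL; rewrite -EE; nra.
exists p; split; first by apply/andP; split => //; lra.
  apply: (le_trans (ltW cp)); apply: ler_wpM2r; lra.
rewrite divff ?gt_eqF//; apply: (@le_trans _ _ (expR 1 * (4 * (p / ln p)))); last first.
  by rewrite mulrCA mulrA.
rewrite mulrC; apply: ler_wpM2l; first exact: expR_ge0.
have -> : Num.sqrt p = E by rewrite [in LHS]EE -expr2 sqrtr_sqr gtr0_norm.
rewrite mulrA ler_pdivlMr//.
have := ler_wpM2l (ltW E0) hL; rewrite -EE; nra.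
Qed.

(** The hypothesis on [alpha] says that [expR (p / alpha)] is at least
    [expR 1 * p].  Doubling [alpha] replaces the exponential by its square root,
    and the other square root absorbs [sqrt c].  If [2 * alpha] exceeds [p], then
    [c = p] works. *)
Lemma choice_alpha p alpha : 2 <= p -> 1 <= alpha <= p / ln (expR 1 * p) ->
  exists c, [/\ 1 <= c <= p, c <= 4 * expR 1 * alpha &
  Num.sqrt c * expR (p / c) <= 4 * expR 1 * expR (p / alpha)].
Proof.
move=> p2 /andP[a1 aL]; have p0 : 0 < p by lra.
have e2 := expR1_ge2.
have a0 : 0 < alpha by lra.
have ep0 : 0 < expR 1 * p by rewrite mulr_gt0// expR_gt0.
have L0 : 0 < ln (expR 1 * p) by apply: ln_gt0; nra.
have epE : expR 1 * p <= expR (p / alpha).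
  rewrite -{1}(@lnK _ (expR 1 * p)) ?posrE// ler_expR ler_pdivlMr// mulrC.
  by rewrite -ler_pdivlMr.
set X := expR (p / alpha) in epE *.
have [cp|cp] := leP (2 * alpha) p.
  exists (2 * alpha); split; first by apply/andP; split => //; lra.
    by apply: ler_wpM2r; lra.
  apply: (@le_trans _ _ X); last by rewrite ler_peMl//; nra.
  apply: sqrt_expR_le; [lra|exact: expR_ge0|].
  rewrite (_ : 2 * (p / (2 * alpha)) = p / alpha); last by field; rewrite gt_eqF.
  rewrite -/X expr2; apply: ler_wpM2r; first exact: expR_ge0.
  nra.
exists p; split; first by apply/andP; split => //; lra.
  by apply: (le_trans (ltW cp)); apply: ler_wpM2r; lra.
rewrite divff ?gt_eqF//; apply: (@le_trans _ _ X); last by rewrite ler_peMl//; nra.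
apply: le_trans epE; rewrite mulrC; apply: ler_wpM2l; first exact: expR_ge0.
rewrite -ler_sqr ?nnegrE ?sqrtr_ge0// ?sqr_sqrtr ?ltW//; nra.
Qed.

End choices_of_c.

Lemma lee_combine (R : realType) (A K c s c' s' : R) (y z : \bar R) :
  0 < A -> 0 <= c -> 0 <= s -> 0 <= c' -> 0 <= s' -> 0 <= K ->
  c <= K * c' -> s <= K * s' -> (0 <= y)%E -> (0 <= z)%E ->
  (A%:E * (c%:E * y + s%:E * z) <= (A * K)%:E * (c'%:E * y + s'%:E * z))%E.
Proof.
move=> A0 c0 s0 c'0 s'0 K0 cc ss y0 z0.
rewrite EFinM -muleA; apply: lee_wpmul2l; first by rewrite lee_fin ltW.
rewrite ge0_muleDr ?mule_ge0 ?lee_fin// !muleA -!EFinM.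
by apply: leeD; apply: lee_wpmul2r; rewrite ?lee_fin.
Qed.

Unset Implicit Arguments.

Theorem theorem5p3 (R : realType) :
  exists A : R, 0 < A /\
  forall (H : completeNormedModType R),
    separable_space H -> is_hilbert H ->
  forall (d : measure_display) (T : measurableType d) (P : probability T R)
    (f : nat -> T -> H),
    M_ind P f ->
    (forall j : nat, (1 <= j)%N -> has_expectation P (increment f j) 0) ->
  forall (p : R), 2 <= p ->
  forall (n : nat), (1 <= n)%N ->
  [/\ forall c : R, 1 <= c <= p ->
        ('N[P]_p%:E [(fun w => (`|f n w|)%:E)]
         <= A%:E * (c%:E * 'N[P]_p%:E [S_ f p]
                    + (Num.sqrt c * expR (p / c))%:E * 'N[P]_2%:E [S_ f 2]))%E,
      ('N[P]_p%:E [(fun w => (`|f n w|)%:E)]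
       <= A%:E * (p%:E * 'N[P]_p%:E [S_ f p]
                  + (Num.sqrt p)%:E * 'N[P]_2%:E [S_ f 2]))%E,
      ('N[P]_p%:E [(fun w => (`|f n w|)%:E)]
       <= A%:E * (p / ln p)%:E * ('N[P]_p%:E [S_ f p] + 'N[P]_2%:E [S_ f 2]))%E
    & forall alpha : R, 1 <= alpha <= p / ln (expR 1 * p) ->
        ('N[P]_p%:E [(fun w => (`|f n w|)%:E)]
         <= A%:E * (alpha%:E * 'N[P]_p%:E [S_ f p]
                    + (expR (p / alpha))%:E * 'N[P]_2%:E [S_ f 2]))%E].
Proof.
have A0 : 0 < 2 * expR (5 / 2) :> R by rewrite mulr_gt0 ?expR_gt0.
have e2 := @expR1_ge2 R.
have K0 : 0 < 4 * expR 1 :> R by lra.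
exists (2 * expR (5 / 2) * (4 * expR 1)); split; first exact: mulr_gt0.
move=> H sepH hilH d T P f Mf Ef p p2 n _.
have Np0 := Lnorm_ge0 P p%:E (S_ f p); have N20 := Lnorm_ge0 P 2%:E (S_ f 2).
have bound c c' s' : 1 <= c <= p -> 0 <= c' -> 0 <= s' -> c <= 4 * expR 1 * c' ->
    Num.sqrt c * expR (p / c) <= 4 * expR 1 * s' ->
    ('N[P]_p%:E [(fun w => (`|f n w|)%:E)] <= (2 * expR (5 / 2) * (4 * expR 1))%:E *
       (c'%:E * 'N[P]_p%:E [S_ f p] + s'%:E * 'N[P]_2%:E [S_ f 2]))%E.
  move=> c1p c'0 s'0 cc ss.
  apply: (le_trans (Lnorm_partial_sum_le sepH hilH Mf Ef n p2 c1p)).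
  by apply: lee_combine => //; move/andP : c1p => []; lra.
split.
- move=> c c1p; have s0 : 0 <= Num.sqrt c * expR (p / c) by rewrite mulr_ge0 ?sqrtr_ge0 ?expR_ge0.
  have c0 : 0 <= c by move/andP : c1p => []; lra.
  by apply: (bound c) => //; rewrite ler_peMl//; lra.
- have p0 : 0 <= p by lra.
  apply: (bound p) => //; [by apply/andP; split => //; lra|by rewrite ler_peMl//; lra|].
  rewrite divff ?gt_eqF//; last lra.
  by rewrite mulrC; apply: ler_wpM2r; rewrite ?sqrtr_ge0//; lra.
- have [c [c1p cc ss]] := choice_p_over_ln p2.
  have r0 : 0 <= p / ln p by rewrite divr_ge0 ?ln_ge0//; lra.
  apply: (le_trans (bound c _ _ c1p r0 r0 cc ss)).
  by rewrite -ge0_muleDr// muleA.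
- move=> alpha alpha1; have [c [c1p cc ss]] := choice_alpha p2 alpha1.
  by apply: (bound c) => //; move/andP : alpha1 => []; lra.
Qed.
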